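(* Let $\mathbf K'_1$ be the class of barycentric subdivisions of cliques with at least four vertices and $\mathbf K_1$ the class of right-angled Coxeter groups whose Coxeter graph is in $\mathbf K'_1$. Then $(\mathbf K_1,\preccurlyeq)$ is uncountably categorical: for every uncountable cardinal $\kappa$, any two groups in $\mathbf K_1$ of cardinality $\kappa$ are isomorphic.
   Context: The barycentric subdivision $\hat\Gamma$ of a graph $\Gamma=(V,E)$ has vertex set the disjoint union of $V$ and $\{c_{a,b}: aEb\}$, with $N(c_{a,b})=\{a,b\}$ and $N(a)=\{c_{a,b}: aEb\}$. A right-angled Coxeter group has a presentation with generating set $S$ (Coxeter basis) and only relations $s^2=e$, $(ss')^2=e$ for some pairs of distinct $s,s'$; its Coxeter graph has vertex set $S$, distinct vertices adjacent iff they commute. $A\preccurlyeq B$ iff $A$ is a subgroup of $B$ and some Coxeter basis $S$ of $B$ has $A\cap S$ a Coxeter basis of $A$. *)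

(* Defs.v *)
From HB Require Import structures.
From mathcomp Require Import all_boot.
From mathcomp Require Import boolp classical_sets functions cardinality.

Set Implicit Arguments.
Unset Strict Implicit.
Unset Printing Implicit Defensive.

Local Open Scope classical_set_scope.
Local Open Scope card_scope.
Local Open Scope group_scope.

Record graph : Type := Graph {
  vertex : Type;
  edge : vertex -> vertex -> Prop;
  edge_sym : forall x y, edge x y -> edge y x;
  edge_irr : forall x, ~ edge x x
}.

Definition graph_isom (Gamma Delta : graph) : Prop :=
  exists2 f : vertex Gamma -> vertex Delta,
    bijective f & forall x y, edge x y <-> edge (f x) (f y).

Definition clique (Gamma : graph) : Prop :=
  forall x y : vertex Gamma, x <> y -> edge x y.

(* The new vertex c_{a,b} is the unordered pair {a, b}: c_{a,b} = c_{b,a}. *)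
Definition edge_set (Gamma : graph) : set (set (vertex Gamma)) :=
  [set c | exists a b, edge a b /\ c = [set a; b]].
Arguments edge_set : clear implicits.

Definition subdivision_edge (Gamma : graph)
    (x y : vertex Gamma + set_type (edge_set Gamma)) : Prop :=
  match x, y with
  | inl a, inr c => (val c : set (vertex Gamma)) a
  | inr c, inl a => (val c : set (vertex Gamma)) a
  | _, _ => False
  end.

Lemma subdivision_edge_sym (Gamma : graph)
    (x y : vertex Gamma + set_type (edge_set Gamma)) :
  subdivision_edge x y -> subdivision_edge y x.
Proof. by case: x; case: y. Qed.

Lemma subdivision_edge_irr (Gamma : graph)
    (x : vertex Gamma + set_type (edge_set Gamma)) :
  ~ subdivision_edge x x.
Proof. by case: x => ? []. Qed.

Definition barycentric_subdivision (Gamma : graph) : graph :=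
  Graph (@subdivision_edge_sym Gamma) (@subdivision_edge_irr Gamma).

Definition K1' (Gamma : graph) : Prop :=
  exists Delta : graph,
    [/\ clique Delta, `I_4 #<= [set: vertex Delta] &
        graph_isom Gamma (barycentric_subdivision Delta)].

(* Group words over X: (x, true) stands for x and (x, false) for x^-1. *)
Definition word (X : Type) : Type := seq (X * bool).

(* Equality of words in < X | R >, the quotient of the free group on X by the
   normal closure of R. *)
Inductive pres_eq (X : Type) (R : set (word X)) : word X -> word X -> Prop :=
| PresRefl u : pres_eq R u u
| PresSym u v : pres_eq R u v -> pres_eq R v u
| PresTrans u v w : pres_eq R u v -> pres_eq R v w -> pres_eq R u w
| PresCancel u x b v : pres_eq R (u ++ [:: (x, b); (x, ~~ b)] ++ v) (u ++ v)
| PresRelator u r v : R r -> pres_eq R (u ++ r ++ v) (u ++ v).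

Definition word_val (G : groupType) (S : set G) (w : word (set_type S)) : G :=
  \prod_(l <- w) (if l.2 then val l.1 else (val l.1)^-1).

Definition has_presentation (G : groupType) (S : set G)
    (R : set (word (set_type S))) : Prop :=
  (forall g : G, exists w : word (set_type S), word_val w = g) /\
  (forall u v : word (set_type S), word_val u = word_val v <-> pres_eq R u v).

Inductive right_angled_relator (X : Type) (M : X -> X -> Prop) :
    word X -> Prop :=
| RelSquare s : right_angled_relator M [:: (s, true); (s, true)]
| RelCommute s t : s <> t -> M s t ->
    right_angled_relator M [:: (s, true); (t, true); (s, true); (t, true)].

Definition coxeter_basis (G : groupType) (S : set G) : Prop :=
  exists M : set_type S -> set_type S -> Prop,
    has_presentation (right_angled_relator M).

Definition coxeter_edge (G : groupType) (S : set G) (s t : set_type S) : Prop :=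
  s <> t /\ commute (val s) (val t).

Lemma coxeter_edge_sym (G : groupType) (S : set G) (s t : set_type S) :
  coxeter_edge s t -> coxeter_edge t s.
Proof. by case=> st c; split; [move=> ts; apply: st | rewrite /commute c]. Qed.

Lemma coxeter_edge_irr (G : groupType) (S : set G) (s : set_type S) :
  ~ coxeter_edge s s.
Proof. by case. Qed.

Definition coxeter_graph (G : groupType) (S : set G) : graph :=
  Graph (@coxeter_edge_sym G S) (@coxeter_edge_irr G S).

Definition K1 (G : groupType) : Prop :=
  exists2 S : set G, coxeter_basis S & K1' (coxeter_graph S).

(* For a subgroup A of B, given as a type with inclusion val : A -> B, the
   preimage val @^-1` S is the intersection of A and S seen as a subset of A. *)
Definition coxeter_sub (B : groupType) (P : pred B) (A : subGroupType P) :
    Prop :=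
  exists2 S : set B,
    coxeter_basis S & coxeter_basis ((val : A -> B) @^-1` S).

Record group_class : Type := GroupClass {
  in_class : groupType -> Prop;
  strong_sub : forall (B : groupType) (P : pred B), subGroupType P -> Prop
}.

Definition group_isom (G H : groupType) : Prop :=
  exists f : {multiplicative G -> H}, bijective f.

(* The cardinal kappa is represented by a type; as usual, categoricity involves
   only the members of the class, not its strong subgroup relation. *)
Definition uncountably_categorical (C : group_class) : Prop :=
  forall kappa : Type, ~ countable [set: kappa] ->
  forall G H : groupType, in_class C G -> in_class C H ->
    [set: G] #= [set: kappa] -> [set: H] #= [set: kappa] ->
  group_isom G H.

(* Main.v *)
From HB Require Import structures.
From mathcomp Require Import all_boot.
From mathcomp Require Import boolp classical_sets functions cardinality.
Require Import Defs.

Set Implicit Arguments.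
Unset Strict Implicit.
Unset Printing Implicit Defensive.

Local Open Scope classical_set_scope.
Local Open Scope card_scope.
Local Open Scope group_scope.

(* The cardinal of an uncountable G in the class determines the clique. If the
   clique has vertex set V, the Coxeter basis has cardinality between |V| and
   |V + V x V|, and G is covered by the words over it. Hence V is infinite
   (else G would be countable), and |V| <= |G| <= |V| by Hessenberg's theorem
   |V x V| = |V|. Two such groups of the same cardinality thus have isomorphic
   cliques, isomorphic Coxeter graphs, and the same presentation. *)

(** * Comparison of cardinals of types *)

Lemma card_leTTP (T U : Type) :
  reflect (exists f : T -> U, injective f) ([set: T] #<= [set: U]).
Proof.
apply: (iffP idP) => [/card_leP[f]|[f fi]]; last first.
  suff /injfunPex[g] : exists2 g : T -> U, set_fun setT setT g & set_inj setT g.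
    exact: inj_card_le g.
  by exists f => // x y _ _; exact: fi.
have gT (x : T) : x \in [set: T] by rewrite inE.
exists (fun x => val (f (SigSub (gT x)))) => x y /val_inj fxy.
by have [] : SigSub (gT x) = SigSub (gT y)
  by apply: (inj (f := f)); rewrite ?inE.
Qed.

Lemma card_eqTTP (T U : Type) :
  reflect (exists f : T -> U, bijective f) ([set: T] #= [set: U]).
Proof.
apply: (iffP card_bijP) => -[f [g fK gK]].
  have gT (X : Type) (x : X) : x \in [set: X] by rewrite inE.
  exists (fun x => val (f (SigSub (gT T x)))).
  exists (fun y => val (g (SigSub (gT U y)))) => x.
    set y := f _; rewrite (_ : SigSub _ = y); last exact: val_inj.
    by rewrite fK.
  set y := g _; rewrite (_ : SigSub _ = y); last exact: val_inj.
  by rewrite gK.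
have gT (X : Type) (x : X) : x \in [set: X] by rewrite inE.
exists (fun x => SigSub (gT U (f (val x)))).
by exists (fun y => SigSub (gT T (g (val y)))) => x; apply: val_inj;
  rewrite /= ?fK ?gK.
Qed.

(** Read from left to right the equivalence makes the relation functional, from right to left
    injective. Being a condition on pairs of elements, it passes to unions of chains, as Zorn's
    lemma requires. *)
Definition partial_injection (T U : Type) (G : set (T * U)) : Prop :=
  forall p q, G p -> G q -> p.1 = q.1 <-> p.2 = q.2.

Lemma chain_common (T : Type) (F : set (set T)) (A B : set T) :
  total_on F subset -> F A -> F B -> exists C, [/\ F C, A `<=` C & B `<=` C].
Proof.
by move=> tF FA FB; have [AB|BA] := tF _ _ FA FB; [exists B|exists A]; split.
Qed.

Lemma partial_injection_bigcup (T U : Type) (F : set (set (T * U))) :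
  total_on F subset -> F `<=` @partial_injection T U ->
  partial_injection (\bigcup_(G in F) G).
Proof.
move=> tF FP p q [A FA Ap] [B FB Bq].
have [C [FC AC BC]] := chain_common tF FA FB.
exact: FP FC _ _ (AC _ Ap) (BC _ Bq).
Qed.

(** A maximal partial injection is total or onto: a point missing from its domain and one missing
    from its range could be paired to enlarge it. *)
Lemma card_leTT_total (T U : Type) :
  [set: T] #<= [set: U] \/ [set: U] #<= [set: T].
Proof.
have [F FP tF|G [Gi Gmax]] := @Zorn_bigcup _ (@partial_injection T U).
  exact: partial_injection_bigcup.
have [dom|/existsNP[x xG]] := pselect (forall x, exists y, G (x, y)).
  have [f fG] := choice dom; left; apply/card_leTTP; exists f => a b fab.
  by apply/(Gi (a, f a) (b, f b)).
right; have [ran|/existsNP[y yG]] := pselect (forall y, exists x, G (x, y)).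
  have [f fG] := choice ran; apply/card_leTTP; exists f => a b fab.
  by apply/(Gi (f a, a) (f b, b)).
exfalso; apply: (Gmax (G `|` [set (x, y)])).
  split=> [p Gp|]; first by left.
  by move=> /(_ (x, y)) xyG; apply: xG; exists y; apply: xyG; right.
move=> [x1 y1] [x2 y2] [G1|[-> ->]] [G2|[-> ->]] //=; first exact: Gi G1 G2.
  by split=> e; [case: xG|case: yG]; rewrite -e; eexists; exact: G1.
by split=> e; [case: xG|case: yG]; rewrite e; eexists; exact: G2.
Qed.

(** * Hessenberg's theorem on squares of infinite cardinals *)

Section Hessenberg.
Variable T : Type.
Implicit Types G : set (T * T * T).

Let side G : set T := [set x | exists y z, G (x, y, z)].

(* A partial pairing is the graph of an injection of A x A into A, where A is
   [side G]. *)
Let pairing G := [/\ partial_injection G,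
  (forall x y, side G x -> side G y -> exists2 z, side G z & G (x, y, z)) &
  (forall x y z, G (x, y, z) -> side G y /\ side G z)].

Let side_sub G H : G `<=` H -> side G `<=` side H.
Proof. by move=> GH x [y [z Gxyz]]; exists y, z; exact: GH. Qed.

Let pairing_bigcup (F : set (set (T * T * T))) :
  total_on F subset -> F `<=` pairing -> pairing (\bigcup_(G in F) G).
Proof.
move=> tF FP; split.
- by apply: partial_injection_bigcup => // G /FP[].
- move=> x y [x1 [x2 [A FA Ax]]] [y1 [y2 [B FB By]]].
  have [C [FC AC BC]] := chain_common tF FA FB.
  have [_ CP _] := FP _ FC.
  have [||z Cz Cxyz] := CP x y.
  + by exists x1, x2; exact: AC.
  + by exists y1, y2; exact: BC.
  by exists z; [apply: side_sub Cz => p Cp|]; exists C.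
- move=> x y z [A FA Axyz]; have [_ _ /(_ _ _ _ Axyz)[Ay Az]] := FP _ FA.
  by split; [apply: side_sub Ay|apply: side_sub Az] => p Ap; exists A.
Qed.

(* [p] restricts to an injection of A x A into A and [g] injects the rest of C
   into A, so C injects into A: tag the two pieces by distinct points of A. *)
Let squeeze (A C : set T) (p : T -> T -> T) (g : T -> T) (a b : T) :
  A a -> A b -> a <> b ->
  (forall x y, A x -> A y -> A (p x y)) ->
  (forall x y x' y', A x -> A y -> A x' -> A y' -> p x y = p x' y' ->
     x = x' /\ y = y') ->
  (forall x, C x -> ~ A x -> A (g x)) ->
  (forall x y, C x -> ~ A x -> C y -> ~ A y -> g x = g y -> x = y) ->
  exists k : T -> T, (forall x, C x -> A (k x)) /\
    (forall x y, C x -> C y -> k x = k y -> x = y).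
Proof.
move=> Aa Ab ab pA pI gA gI.
exists (fun x => if pselect (A x) then p x a else p (g x) b).
split=> [x Cx|x y Cx Cy].
  by case: pselect => Ax; apply: pA => //; exact: gA.
case: pselect => Ax; case: pselect => Ay /pI[]//; try exact: gA.
- by move=> _ /esym.
- by move=> /gI ->.
Qed.

(** Take a maximal pairing, with side A. If the complement of A injects into A, then so does T, and
    the pairing of A serves for T. Otherwise the complement contains a copy B of A, and the pairing
    extends to the union of A and B with new values in B, against maximality. *)
Theorem card_le_square : [set: nat] #<= [set: T] ->
  [set: T * T] #<= [set: T].
Proof.
move=> /card_leTTP[j jI].
pose G0 := [set t : T * T * T |
  exists m n, t = (j m, j n, j (choice.pickle (m, n)))].
have side0 n : side G0 (j n).
  by exists (j n), (j (choice.pickle (n, n))), n, n.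
have P0 : pairing G0.
  split.
  - move=> _ _ [m [n ->]] [m' [n' ->]] /=; split=> [[/jI-> /jI->]//|].
    by move=> /jI/(pcan_inj choice.pickleK)[-> ->].
  - move=> x y [? [? [m [? [-> _ _]]]]] [? [? [n [? [-> _ _]]]]].
    by exists (j (choice.pickle (m, n))); [exact: side0|exists m, n].
  - by move=> x y z [m [n [_ -> ->]]].
(* Zorn's lemma also tests the empty chain, whose union is empty, so containing [G0] can only be
   asked of nonempty pairings. A maximal one is nonempty, since [G0] itself satisfies [Q]. *)
pose Q G := pairing G /\ (G !=set0 -> G0 `<=` G).
have [F FQ tF|G [[[GI Gtot Gside] GG0] Gmax]] := @Zorn_bigcup _ Q.
  split; first by apply: pairing_bigcup => // A /FQ[].
  move=> [p [A FA Ap]] q G0q; exists A => //.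
  by have [_ AG0] := FQ _ FA; apply: AG0 => //; exists p.
have {}GG0 : G0 `<=` G.
  apply: GG0; apply: contrapT => GN; apply: (Gmax G0); last by split=> // _ ?.
  split=> [p Gp|/(_ (j 0, j 0, j (choice.pickle (0, 0)))) G00].
    by exfalso; apply: GN; exists p.
  by apply: GN; eexists; apply: G00; exists 0, 0.
pose A := side G.
have Aj n : A (j n) by exact: side_sub (side0 n).
have j01 : j 0%N <> j 1%N by move=> /jI.
(* The memberships stay under the existential so that [p] is a function on all of T x T, arbitrary
   off A x A. *)
have /choice[p pP] (xy : T * T) :
    exists z, A xy.1 -> A xy.2 -> A z /\ G (xy, z).
  case: xy => x y /=.
  have [[Ax Ay]|nA] := pselect (A x /\ A y); last first.
    by exists x => Ax Ay; case: nA.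
  by have [z Az Gz] := Gtot _ _ Ax Ay; exists z.
have pA x y (Ax : A x) (Ay : A y) := (pP (x, y) Ax Ay).1.
have pI x y x' y' : A x -> A y -> A x' -> A y' -> p (x, y) = p (x', y') ->
    x = x' /\ y = y'.
  move=> Ax Ay Ax' Ay' pp.
  have [_ G1] := pP (x, y) Ax Ay; have [_ G2] := pP (x', y') Ax' Ay'.
  by have /= [-> ->] := (GI _ _ G1 G2).2 pp.
have [|] := card_leTT_total {x | ~ A x} {x | A x} => /card_leTTP[g gI].
  (* Here [r] sends the complement of A injectively into A, so [squeeze] applies with C the whole
     type. *)
  pose r x :=
    if pselect (~ A x) is left nAx then sval (g (exist _ x nAx)) else x.
  have rA x : ~ A x -> A (r x).
    by rewrite /r; case: pselect => // nAx _; exact: svalP.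
  have rI x y : ~ A x -> ~ A y -> r x = r y -> x = y.
    rewrite /r; case: pselect => // nAx _; case: pselect => // nAy _.
    move=> /eq_sig_hprop grr.
    by have [] := gI _ _ (grr (fun _ => @Prop_irrelevance _)).
  have [|k [kA kI]] := @squeeze A setT (fun x y => p (x, y)) r _ _
      (Aj 0%N) (Aj 1%N) j01 pA pI (fun x _ => rA x).
    by move=> x y _ nAx _ nAy; exact: rI.
  apply/card_leTTP; exists (fun xy => p (k xy.1, k xy.2)) => -[x y] [x' y'] /=.
  by case/pI; do ?[exact: kA]; move=> /kI-> // /kI->.
(* Now [r] goes the other way, from A injectively into its complement; [s] below inverts it on its
   image B. *)
pose r x := if pselect (A x) is left Ax then sval (g (exist _ x Ax)) else x.
have rA x : A x -> ~ A (r x).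
  by rewrite /r; case: pselect => // Ax _; exact: (svalP (g _)).
have rI x y : A x -> A y -> r x = r y -> x = y.
  rewrite /r; case: pselect => // Ax _; case: pselect => // Ay _.
  move=> /eq_sig_hprop grr.
  by have [] := gI _ _ (grr (fun _ => @Prop_irrelevance _)).
pose B := r @` A; pose C := A `|` B.
have /choice[s sP] y : exists x, B y -> A x /\ r x = y.
  have [[x Ax rx]|nB] := pselect (B y); first by exists x.
  by exists y => /nB.
have CB x : C x -> ~ A x -> B x by move=> [].
have [||k [kA kI]] := @squeeze A C (fun x y => p (x, y)) s _ _
  (Aj 0%N) (Aj 1%N) j01 pA pI.
- by move=> x Cx nAx; have [] := sP x (CB _ Cx nAx).
- move=> x y Cx nAx Cy nAy sxy.
  have [_ <-] := sP x (CB _ Cx nAx); have [_ <-] := sP y (CB _ Cy nAy).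
  by rewrite sxy.
(* Squeeze both coordinates into A, pair them there, and move the result into B. Values of [h] thus
   avoid A, which contains all values of G. *)
pose h x y := r (p (k x, k y)).
have hB x y : C x -> C y -> B (h x y).
  by move=> Cx Cy; exists (p (k x, k y)) => //; apply: pA; exact: kA.
have hA x y : C x -> C y -> ~ A (h x y).
  by move=> Cx Cy; apply: rA; apply: pA; exact: kA.
have hI x y x' y' : C x -> C y -> C x' -> C y' -> h x y = h x' y' ->
    x = x' /\ y = y'.
  move=> Cx Cy Cx' Cy' /rI pp.
  have {}pp : p (k x, k y) = p (k x', k y').
    by apply: pp; apply: pA; exact: kA.
  by have [||||/kI-> // /kI->] := pI _ _ _ _ _ _ _ _ pp; try exact: kA.
pose H := G `|` [set t | [/\ C t.1.1, C t.1.2, ~ (A t.1.1 /\ A t.1.2) &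
  t.2 = h t.1.1 t.1.2]].
have GA x y z : G (x, y, z) -> [/\ A x, A y & A z].
  by move=> Gxyz; have [Ay Az] := Gside _ _ _ Gxyz; split=> //; exists y, z.
have GH : G `<=` H by move=> t; left.
have HC : side H = C.
  apply/seteqP; split=> x; first by move=> [y [z [/GA[Ax _ _]|[]//]]]; left.
  have [Ax _|nAx Cx] := pselect (A x); first exact: side_sub Ax.
  by exists x, (h x x); right; split=> //= -[].
exfalso; apply: (Gmax H).
  (* The extension is proper: its side contains [r (j 0)], which lies outside A. *)
  split=> // HG; pose x := r (j 0).
  have Cx : C x by right; exists (j 0).
  have nAx : ~ A x by exact: rA.
  have : H (x, x, h x x) by right; split=> // -[].
  by move=> /HG/GA[].
split=> [|_]; last by move=> q /GG0; exact: GH.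
split; rewrite ?HC.
- move=> [[x y] z] [[x' y'] z'].
  move=> [G1|/= [Cx Cy nxy ->]] [G2|/= [Cx' Cy' nxy' ->]].
  + exact: GI G1 G2.
  + have [Ax Ay Az] := GA _ _ _ G1; split=> /= [[ex ey]|ez].
      by case: nxy'; rewrite -ex -ey.
    by case: (hA _ _ Cx' Cy'); rewrite -ez.
  + have [Ax Ay Az] := GA _ _ _ G2; split=> /= [[ex ey]|ez].
      by case: nxy; rewrite ex ey.
    by case: (hA _ _ Cx Cy); rewrite ez.
  + by split=> /= [[-> ->]//|/hI[]// -> ->].
- move=> x y Cx Cy; have [[Ax Ay]|nA] := pselect (A x /\ A y).
    by have [z Az Gz] := Gtot _ _ Ax Ay; exists z; left.
  by exists (h x y); right => //; exact: hB.
- move=> x y z [/GA[_ Ay Az]|/= [Cx Cy _ ->]]; first by split; left.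
  by split=> //; right; exact: hB.
Qed.

End Hessenberg.

(** * Cardinal bounds for words, presented groups and subdivisions *)

Lemma card_le_seq (T : Type) : [set: nat] #<= [set: T] ->
  [set: seq T] #<= [set: T].
Proof.
move=> natT; have /card_leTTP[p pI] := card_le_square natT.
have /card_leTTP[j jI] := natT.
(* The end marker [j 0] may itself be a value of [p], so [code] is injective only on lists of equal
   length; the length is recorded beside it. *)
pose code := foldr (fun x y => p (x, y)) (j 0).
apply/card_leTTP; exists (fun s => p (j (size s), code s)) => s t.
move=> /pI[/jI]; elim: s t => [|x s IHs] [|y t] //= [est] /pI[-> est'].
by rewrite (IHs t).
Qed.

Lemma card_le_presented_group (G : groupType) (S : set G)
    (R : set (word (set_type S))) (T : Type) :
  has_presentation R -> [set: nat] #<= [set: T] ->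
  [set: set_type S] #<= [set: T] -> [set: G] #<= [set: T].
Proof.
move=> [gen _] natT /card_leTTP[f fI].
have /card_leTTP[p pI] := card_le_square natT.
have /card_leTTP[j jI] := natT.
have [w wP] := choice gen.
pose code (l : set_type S * bool) := p (f l.1, j l.2).
have codeI : injective code.
  move=> [s b] [t c] /pI[/fI /= -> /jI]; by case: b c => -[].
apply: card_le_trans (card_le_seq natT).
apply/card_leTTP; exists (fun g => map code (w g)) => g h /(inj_map codeI) wgh.
by rewrite -(wP g) wgh.
Qed.

Lemma card_le_subdivision (Gamma : graph) (T : Type) :
  [set: nat] #<= [set: T] -> [set: vertex Gamma] #<= [set: T] ->
  [set: vertex (barycentric_subdivision Gamma)] #<= [set: T].
Proof.
move=> natT /card_leTTP[f fI].
have /card_leTTP[p pI] := card_le_square natT.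
have /card_leTTP[j jI] := natT.
have /choice[e eP] (c : set_type (edge_set Gamma)) :
    exists ab : vertex Gamma * vertex Gamma, val c = [set ab.1; ab.2].
  by have /set_mem[a [b [_ cab]]] := valP c; exists (a, b).
apply/card_leTTP.
(* The tags [j 0] and [j 1] separate old vertices from midpoints; a midpoint is coded by a chosen
   ordering of its endpoints. *)
exists (fun x => match x with
  | inl a => p (j 0, f a)
  | inr c => p (j 1%N, p (f (e c).1, f (e c).2))
  end).
move=> [a|c] [b|d] /pI[]; [by move=> /fI->|by move=> /jI|by move=> /jI|].
move=> /pI[/fI e1 /fI e2]; congr inr; apply: val_inj.
by rewrite (eP c) (eP d) e1 e2.
Qed.

(** * Isomorphisms of graphs, cliques and subdivisions *)

Lemma graph_isom_sym (Gamma Delta : graph) :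
  graph_isom Gamma Delta -> graph_isom Delta Gamma.
Proof.
move=> [f [g fK gK] fE]; exists g; first by exists f.
by move=> x y; rewrite fE !gK.
Qed.

Lemma graph_isom_trans (Delta Gamma Theta : graph) :
  graph_isom Gamma Delta -> graph_isom Delta Theta -> graph_isom Gamma Theta.
Proof.
move=> [f fB fE] [g gB gE]; exists (g \o f); first exact: bij_comp.
by move=> x y; rewrite fE gE.
Qed.

(** In a clique adjacency is just distinctness, which every bijection preserves and reflects. *)
Lemma clique_isom (Gamma Delta : graph) : clique Gamma -> clique Delta ->
  [set: vertex Gamma] #= [set: vertex Delta] -> graph_isom Gamma Delta.
Proof.
move=> cG cD /card_eqTTP[f fB]; exists f => // x y; split=> [xy|fxy].
  by apply: cD => /(bij_inj fB) e; apply: (@edge_irr Gamma y); rewrite -{1}e.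
by apply: cG => e; apply: (@edge_irr Delta (f y)); rewrite -{1}e.
Qed.

Lemma edge_set_image (Gamma Delta : graph) (f : vertex Gamma -> vertex Delta) :
  (forall x y, edge x y -> edge (f x) (f y)) ->
  forall c : set_type (edge_set Gamma), f @` val c \in edge_set Delta.
Proof.
move=> fE c; have /set_mem[a [b [ab ->]]] := valP c.
rewrite inE; exists (f a), (f b); split; first exact: fE.
by rewrite image_setU !image_set1.
Qed.

Definition subdivision_map (Gamma Delta : graph)
    (f : vertex Gamma -> vertex Delta)
    (fE : forall x y, edge x y -> edge (f x) (f y))
    (x : vertex (barycentric_subdivision Gamma)) :
    vertex (barycentric_subdivision Delta) :=
  match x with
  | inl a => inl (f a)
  | inr c => inr (SigSub (edge_set_image fE c))
  end.

Lemma subdivision_mapK (Gamma Delta : graph)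
    (f : vertex Gamma -> vertex Delta) (g : vertex Delta -> vertex Gamma)
    (fE : forall x y, edge x y -> edge (f x) (f y))
    (gE : forall x y, edge x y -> edge (g x) (g y)) :
  cancel f g -> cancel (subdivision_map fE) (subdivision_map gE).
Proof.
move=> fK [a|c] /=; first by rewrite fK.
congr inr; apply: val_inj => /=.
rewrite image_comp (eq_imagel (f' := id)) ?image_id //.
by move=> x _ /=; rewrite fK.
Qed.

(** Midpoints are sets of endpoints, so they are carried by direct image. Incidence is membership,
    which direct image under an injective map reflects. *)
Lemma subdivision_isom (Gamma Delta : graph) : graph_isom Gamma Delta ->
  graph_isom (barycentric_subdivision Gamma) (barycentric_subdivision Delta).
Proof.
move=> [f [g fK gK] fE].
have fE' x y : edge x y -> edge (f x) (f y) by move/fE.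
have gE' x y : edge x y -> edge (g x) (g y) by rewrite fE !gK.
exists (subdivision_map fE').
  by exists (subdivision_map gE'); exact: subdivision_mapK.
have mem (c : set (vertex Gamma)) a : c a <-> (f @` c) (f a).
  by split=> [ca|[b cb /(can_inj fK) <-]//]; exists a.
by case=> [a|c] [b|d] //=; exact: mem.
Qed.

(** * Presentations and right-angled Coxeter groups *)

Lemma word_val_cat (G : groupType) (S : set G) (u v : word (set_type S)) :
  word_val (u ++ v) = word_val u * word_val v.
Proof. by rewrite /word_val big_cat. Qed.

Lemma word_val_relator (G : groupType) (S : set G)
    (R : set (word (set_type S))) (r : word (set_type S)) :
  has_presentation R -> R r -> word_val r = 1.
Proof.
move=> [_ valP] Rr; have /valP := @PresRelator _ R [::] r [::] Rr.
by rewrite cats0 /= => ->; rewrite /word_val big_nil.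
Qed.

Lemma pres_eq_map (X Y : Type) (f : X -> Y) (R : set (word X))
    (R' : set (word Y)) (u v : word X) :
  let fw w := [seq (f l.1, l.2) | l <- w] in
  (forall r, R r -> R' (fw r)) -> pres_eq R u v -> pres_eq R' (fw u) (fw v).
Proof.
move=> fw fR; elim=> {u v}.
- by move=> u; exact: PresRefl.
- by move=> u v _; exact: PresSym.
- by move=> u v w _ uv _; exact: PresTrans.
- by move=> u x b v; rewrite /fw !map_cat; exact: PresCancel.
- by move=> u r v /fR Rr; rewrite /fw !map_cat; exact: PresRelator.
Qed.

Lemma pres_eq_sub (X : Type) (R R' : set (word X)) (u v : word X) :
  R `<=` R' -> pres_eq R u v -> pres_eq R' u v.
Proof.
move=> RR' /(@pres_eq_map _ _ id _ R').
have idw (w : word X) : [seq (id l.1, l.2) | l <- w] = w.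
  by rewrite (eq_map (g := id)) ?map_id // => -[].
by rewrite !idw; apply=> r; rewrite idw; exact: RR'.
Qed.

(** The easy half of a presentation: once the relators hold in G, so do all their consequences. *)
Lemma pres_eq_word_val (G : groupType) (S : set G)
    (R : set (word (set_type S))) (u v : word (set_type S)) :
  (forall r, R r -> word_val r = 1) -> pres_eq R u v ->
  word_val u = word_val v.
Proof.
move=> R1; elim=> {u v} //.
- by move=> u v w _ -> _.
- move=> u x b v; rewrite !word_val_cat; congr (_ * _).
  rewrite /word_val !big_cons big_nil /=.
  by case: b; rewrite /= mulg1 ?mulgV ?mulVg mul1g.
- by move=> u r v Rr; rewrite !word_val_cat (R1 r) // mul1g.
Qed.

(* The defining commutations are not assumed to be all those that hold in G;
   adding the missing ones does not change the presented group, because they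
   are consequences of the given ones. *)
Lemma coxeter_basis_graph (G : groupType) (S : set G) : coxeter_basis S ->
  has_presentation (right_angled_relator (@coxeter_edge G S)).
Proof.
move=> [M pM]; have [gen valP] := pM; split=> // u v.
have sq (s : set_type S) : val s * val s = 1.
  rewrite -(word_val_relator pM (RelSquare M s)).
  by rewrite /word_val !big_cons big_nil /= mulg1.
have inv (s : set_type S) : (val s)^-1 = val s.
  by rewrite -[LHS]mulg1 -(sq s) mulKg.
split=> [/valP|]; last first.
  apply: pres_eq_word_val => r [s|s t _ [_ st]].
    by rewrite /word_val !big_cons big_nil /= mulg1 sq.
  rewrite /word_val !big_cons big_nil /= mulg1 mulgA.
  by rewrite {1}st -mulgA (mulgA (val s)) sq mul1g sq.
apply: pres_eq_sub => r [s|s t st Mst]; first exact: RelSquare.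
apply: RelCommute => //; split=> //.
have := word_val_relator pM (RelCommute st Mst).
rewrite /word_val !big_cons big_nil /= mulg1 mulgA => stst.
rewrite /commute -[LHS]mulg1 -(mulgV (val s * val t)) mulgA stst mul1g.
by rewrite invgM !inv.
Qed.

(** With the commutations read off the Coxeter graphs, a graph isomorphism matches the relators of
    both presentations, so relabelling letters induces inverse maps between the groups. *)
Lemma coxeter_graph_group_isom (G H : groupType) (S : set G) (T : set H) :
  coxeter_basis S -> coxeter_basis T ->
  graph_isom (coxeter_graph S) (coxeter_graph T) -> group_isom G H.
Proof.
move=> /coxeter_basis_graph[genS valS] /coxeter_basis_graph[genT valT].
move=> [f [g fK gK] fE].
pose fw (w : word (set_type S)) := [seq (f l.1, l.2) | l <- w].
pose gw (w : word (set_type T)) := [seq (g l.1, l.2) | l <- w].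
have fwK : cancel fw gw by apply: mapK => -[s b] /=; rewrite fK.
have gwK : cancel gw fw by apply: mapK => -[s b] /=; rewrite gK.
have fwE u v : word_val u = word_val v -> word_val (fw u) = word_val (fw v).
  move=> /valS uv; apply/valT; apply: pres_eq_map uv => r.
  case=> [s|s t st]; first exact: RelSquare.
  move=> /fE st'; apply: RelCommute => //; by move/(can_inj fK).
have gwE u v : word_val u = word_val v -> word_val (gw u) = word_val (gw v).
  move=> /valT uv; apply/valS; apply: pres_eq_map uv => r.
  case=> [s|s t st]; first exact: RelSquare.
  move=> st'; apply: RelCommute; first by move/(can_inj gK).
  by apply/fE; rewrite !gK.
have [w wP] := choice genS; have [z zP] := choice genT.
(* By [fwE] and [gwE] the values do not depend on the chosen words. *)
pose phi a := word_val (fw (w a)); pose psi b := word_val (gw (z b)).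
have phiM : {morph phi : x y / x * y}.
  move=> x y; rewrite /phi -word_val_cat -map_cat; apply: fwE.
  by rewrite word_val_cat !wP.
pose phim := isMultiplicative.Build G H phi phiM.
pose Phi : {multiplicative G -> H} := HB.pack phi phim.
exists Phi; exists psi => x /=.
  by rewrite /psi -[RHS]wP -(fwK (w x)); apply: gwE; rewrite zP.
by rewrite /phi -[RHS]zP -(gwK (z x)); apply: fwE; rewrite wP.
Qed.

(** * The cardinal of the clique, and categoricity *)

Lemma card_subdivision_group (G : groupType) (S : set G) (Delta : graph) :
  ~ countable [set: G] -> coxeter_basis S ->
  graph_isom (coxeter_graph S) (barycentric_subdivision Delta) ->
  [set: vertex Delta] #= [set: G].
Proof.
move=> Gunc [M pM] [f fB fE].
(* Used twice: with T the vertex set for the upper bound on G, and with T = [nat] to see that a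
   finite vertex set would make G countable. *)
have GT (T : Type) : [set: nat] #<= [set: T] ->
    [set: vertex Delta] #<= [set: T] -> [set: G] #<= [set: T].
  move=> natT VT; apply: (card_le_presented_group pM natT).
  apply: card_le_trans (card_le_subdivision natT VT).
  by apply/card_leTTP; exists f; exact: bij_inj.
rewrite card_eq_le; apply/andP; split.
  have [g fK gK] := fB.
  apply/card_leTTP; exists (fun a => val (g (inl a))) => a b /val_inj.
  by move=> /(can_inj gK)[].
apply: (GT _ _ (card_lexx _)); apply/infiniteP => /finite_set_countable Vc.
exact/Gunc/GT.
Qed.

Theorem theorem5p13 : uncountably_categorical (GroupClass K1 (@coxeter_sub)).
Proof.
move=> kappa kunc G H /= [S bS [D [cD _ iS]]] [T bT [E [cE _ iT]]] Gk Hk.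
have Gunc : ~ countable [set: G] by rewrite (eq_countable Gk).
have Hunc : ~ countable [set: H] by rewrite (eq_countable Hk).
have VG := card_subdivision_group Gunc bS iS.
have VH := card_subdivision_group Hunc bT iT.
apply: (coxeter_graph_group_isom bS bT); apply: graph_isom_trans iS _.
apply: graph_isom_trans (graph_isom_sym iT); apply: subdivision_isom.
apply: clique_isom => //; apply: card_eq_trans VG _.
by apply: card_eq_trans Gk _; rewrite card_eq_sym; exact: card_eq_trans VH Hk.
Qed.
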